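(* For any integer $n \ge 4$, there are only finitely many signatures $\mathbf{p} = (p_1,\ldots,p_n)$ (sequences of positive integers with $\sum_{i=1}^n 1/p_i < 1$) such that the canonical ring $R$ associated with $\mathbf{p}$ is a hypersurface.
   Context: Let $n\ge 4$. A signature is a sequence $\mathbf{p}=(p_1,\ldots,p_n)$ of positive integers with $\sum_{i=1}^n \frac1{p_i}<1$. Let $L$ be the rank-one abelian group $L=(\mathbb{Z}\vec{X}_1\oplus\cdots\oplus\mathbb{Z}\vec{X}_n\oplus\mathbb{Z}\vec{c})/(p_i\vec{X}_i-\vec{c} : 1\le i\le n)$, and let $T=\mathbb{C}[X_1,\ldots,X_n]/(\sum_{i=1}^n X_i^{p_i})$, graded by $L$ with $X_i$ in degree $\vec{X}_i$; write $T_{\vec v}$ for the degree $\vec v$ part. The dualizing element is $\vec\omega=\vec c-\sum_{i=1}^n\vec X_i\in L$, and the canonical ring is the $\mathbb{Z}$-graded subring $R=\bigoplus_{k=0}^\infty R_k$ of $T$, with $R_k=T_{k\vec\omega}$. Let $\mathfrak m=\bigoplus_{k\ge1}R_k$. The embedding dimension of $R$ is $\dim_{\mathbb C}\mathfrak m/\mathfrak m^2$, and $R$ is called a hypersurface if its embedding dimension equals its Krull dimension plus one (as $R$ has Krull dimension $n-1$, this means $\dim_{\mathbb C}\mathfrak m/\mathfrak m^2=n$). *)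

(* Defs.v *)
From HB Require Import structures.
From mathcomp Require Import all_boot all_order all_algebra.
From mathcomp Require Import mpoly.
From mathcomp Require Import boolp classical_sets cardinality.

Set Implicit Arguments.
Unset Strict Implicit.
Unset Printing Implicit Defensive.

Import GRing.Theory.
Import Quotient.Exports.
Local Open Scope ring_scope.
Local Open Scope quotient_scope.

(* Everything is set up over an arbitrary field K, to be instantiated with the
   complex numbers R[i], for R : realType. *)

Definition is_signature (n : nat) (p : {ffun 'I_n -> nat}) : bool :=
  [forall i, 0 < p i]%N && (\sum_i (p i)%:R^-1 < 1 :> rat).

Record signature (n : nat) := Signature {
  sigval :> {ffun 'I_n -> nat};
  sigvalP : is_signature sigval
}.
HB.instance Definition _ n := [isSub for @sigval n].

Lemma sig_gt0 n (p : signature n) i : (0 < p i)%N.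
Proof. by case/andP: (sigvalP p) => /forallP. Qed.

Section GradingGroup.
Variables (n : nat) (p : signature n).

(* The free abelian group on X_1, ..., X_n (first component) and c (second). *)
Definition freeL : zmodType := ({ffun 'I_n -> int} * int)%type.
Definition freeX (i : 'I_n) : freeL := ([ffun j => (j == i)%:R], 0).
Definition freec : freeL := (0, 1).

(* The subgroup generated by the p_i X_i - c. *)
Definition relL (v : freeL) : bool :=
  `[< exists a : 'I_n -> int, v = \sum_i (freeX i *+ p i - freec) *~ a i >].

Fact relL_zmod_closed : zmod_closed relL.
Proof.
split; first by apply/asboolP; exists (fun=> 0); rewrite big1.
move=> u v /asboolP[a ->] /asboolP[b ->]; apply/asboolP.
exists (fun i => a i - b i); rewrite -sumrB.
by apply: eq_bigr => i _; rewrite mulrzBr.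
Qed.
HB.instance Definition _ := GRing.isZmodClosed.Build freeL relL relL_zmod_closed.

Definition L : zmodType := Quotient.quot (GRing.ZmodClosed.clone freeL relL _).
Definition Xvec (i : 'I_n) : L := \pi_L (freeX i).
Definition cvec : L := \pi_L freec.

Definition omega : L := cvec - \sum_i Xvec i.

Definition mdegL (m : 'X_{1..n}) : L := \sum_i Xvec i *+ m i.

Lemma mdegL0 : mdegL 0%MM = 0.
Proof. by rewrite /mdegL big1 // => i _; rewrite mnm0E. Qed.

Lemma mdegLD m1 m2 : mdegL (m1 + m2)%MM = mdegL m1 + mdegL m2.
Proof.
by rewrite /mdegL -big_split; apply: eq_bigr => i _; rewrite mnmDE mulrnDr.
Qed.

End GradingGroup.

Section CanonicalRing.
Variables (K : fieldType) (n : nat) (p : signature n).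

Definition fermat : {mpoly K[n]} := \sum_i 'X_i ^+ p i.

Definition fermat_ideal (P : {mpoly K[n]}) : bool :=
  `[< exists Q, P = Q * fermat >].

Fact fermat_idealr_closed : idealr_closed fermat_ideal.
Proof.
split.
- by apply/asboolP; exists 0; rewrite mul0r.
- apply/asboolP => -[Q /(congr1 (fun P => P.@[fun=> 0]))].
  rewrite mevalM meval1 /fermat raddf_sum big1 ?mulr0; first exact/eqP/oner_neq0.
  by move=> i _ /=; rewrite rmorphXn /= mevalXU expr0n gtn_eqF ?sig_gt0.
- move=> P _ _ /asboolP[Q1 ->] /asboolP[Q2 ->]; apply/asboolP.
  by exists (P * Q1 + Q2); rewrite mulrDl mulrA.
Qed.
HB.instance Definition _ :=
  isIdealr.Build {mpoly K[n]} fermat_ideal fermat_idealr_closed.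

Definition T := {ideal_quot (Idealr.clone {mpoly K[n]} fermat_ideal _)}.
HB.instance Definition _ := GRing.ComNzRing.on T.

Definition scaleT (a : K) (t : T) : T := \pi_T a%:MP * t.

Fact scaleTA a b t : scaleT a (scaleT b t) = scaleT (a * b) t.
Proof. by rewrite /scaleT mulrA -rmorphM -mpolyCM. Qed.
Fact scale1T : left_id 1 scaleT.
Proof. by move=> t; rewrite /scaleT mpolyC1 rmorph1 mul1r. Qed.
Fact scaleTDr : right_distributive scaleT +%R.
Proof. by move=> a u v; rewrite /scaleT mulrDr. Qed.
Fact scaleTDl t : {morph scaleT^~ t : a b / a + b}.
Proof. by move=> a b; rewrite /scaleT mpolyCD rmorphD mulrDl. Qed.
HB.instance Definition _ :=
  GRing.Zmodule_isLmodule.Build K T scaleTA scale1T scaleTDr scaleTDl.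
Fact scaleTAl (a : K) (u v : T) : a *: (u * v) = (a *: u) * v.
Proof. by rewrite /GRing.scale /= /scaleT mulrA. Qed.
HB.instance Definition _ := GRing.Lmodule_isLalgebra.Build K T scaleTAl.
HB.instance Definition _ := GRing.Lalgebra_isComAlgebra.Build K T.

Definition Tpart (v : L p) : set T := [set t | exists P : {mpoly K[n]},
  (forall m, m \in msupp P -> mdegL p m = v) /\ t = \pi_T P].

Lemma Tpart0 v : Tpart v 0.
Proof. by exists 0; split; [move=> m; rewrite msupp0 | rewrite raddf0]. Qed.

Lemma TpartD v t u : Tpart v t -> Tpart v u -> Tpart v (t + u).
Proof.
move=> [P [hP ->]] [Q [hQ ->]]; exists (P + Q); split; last by rewrite raddfD.
by move=> m /msuppD_le; rewrite mem_cat => /orP[/hP|/hQ].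
Qed.

Lemma TpartM v w t u : Tpart v t -> Tpart w u -> Tpart (v + w) (t * u).
Proof.
move=> [P [hP ->]] [Q [hQ ->]]; exists (P * Q); split; last by rewrite rmorphM.
move=> m /msuppM_le /allpairsP[[m1 m2] /= [/hP <- /hQ <- ->]].
exact: mdegLD.
Qed.

Lemma TpartC a : Tpart 0 (\pi_T a%:MP).
Proof.
exists a%:MP; split => // m; rewrite msuppC; case: ifP => //= _.
by rewrite inE => /eqP->; apply: mdegL0.
Qed.

Lemma TpartZ a v t : Tpart v t -> Tpart v (a *: t).
Proof. by move=> ht; rewrite -[v]add0r; apply/TpartM/ht/TpartC. Qed.

(* The sum of the T_{k omega} is direct: omega has infinite order in L, as the
   degree map X_i |-> 1 / p_i, c |-> 1 sends it to 1 - \sum_i 1 / p_i > 0. *)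
Definition is_canonical (t : T) : bool :=
  `[< exists N (r : nat -> T),
        (forall k, Tpart (omega p *+ k) (r k)) /\ t = \sum_(k < N) r k >].

Lemma is_canonical_part k t : Tpart (omega p *+ k) t -> is_canonical t.
Proof.
move=> ht; apply/asboolP; exists k.+1, (fun j => if j == k then t else 0).
split=> [j|]; first by case: eqP => [->|_] //; apply: Tpart0.
rewrite big_ord_recr /= eqxx big1 ?add0r // => j _.
by rewrite ltn_eqF.
Qed.

Lemma is_canonical0 : is_canonical 0.
Proof. by apply: (@is_canonical_part 0); apply: Tpart0. Qed.

Lemma is_canonicalD t u :
  is_canonical t -> is_canonical u -> is_canonical (t + u).
Proof.
move=> /asboolP[N [r [hr ->]]] /asboolP[M [s [hs ->]]]; apply/asboolP.
exists (N + M)%N.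
exists (fun k => (if (k < N)%N then r k else 0) +
                (if (k < M)%N then s k else 0)).
split=> [k|].
  by apply: TpartD; case: ifP => // _; apply: Tpart0.
rewrite big_split /= -!big_mkcond /=; congr (_ + _).
- exact: big_ord_widen (leq_addr M N).
- exact: big_ord_widen (leq_addl N M).
Qed.

Fact canonical_subalg_closed : GRing.subsemialg_closed is_canonical.
Proof.
have sumC N (F : 'I_N -> T) : (forall i, is_canonical (F i)) ->
    is_canonical (\sum_i F i).
  by move=> hF; elim/big_ind: _ => //;
    [apply: is_canonical0 | apply: is_canonicalD].
split.
- apply: (@is_canonical_part 0).
  have -> : 1 = \pi_T 1%:MP :> T by rewrite mpolyC1 rmorph1.
  exact: TpartC.
- split; [exact: is_canonical0 | exact: is_canonicalD].
- move=> a _ /asboolP[N [r [hr ->]]]; rewrite scaler_sumr.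
  by apply: sumC => i; apply/is_canonical_part/TpartZ/hr.
- move=> _ _ /asboolP[N [r [hr ->]]] /asboolP[M [s [hs ->]]].
  rewrite mulr_suml; apply: (sumC) => i; rewrite mulr_sumr; apply: (sumC) => j.
  by apply: (@is_canonical_part (i + j)); rewrite mulrnDr; apply: TpartM.
Qed.
HB.instance Definition _ :=
  GRing.isSubalgClosed.Build K T is_canonical canonical_subalg_closed.

Record canring := Canring { canval :> T; canvalP : is_canonical canval }.
HB.instance Definition _ := [isSub for canval].
HB.instance Definition _ := [Choice of canring by <:].
HB.instance Definition _ := [SubChoice_isSubComNzRing of canring by <:].
HB.instance Definition _ := [SubZmodule_isSubLmodule of canring by <:].
HB.instance Definition _ :=
  [SubNzRing_SubLmodule_isSubLalgebra of canring by <:].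
HB.instance Definition _ := [SubLalgebra_isSubAlgebra of canring by <:].

Definition canpart (k : nat) : set canring :=
  [set r | Tpart (omega p *+ k) (val r)].

Definition maxideal : set canring := [set x | exists N (r : nat -> canring),
  (forall k, canpart k.+1 (r k)) /\ x = \sum_(k < N) r k].

End CanonicalRing.

Definition ideal_mul (A : comNzRingType) (I J : set A) : set A :=
  [set x | exists N (a b : 'I_N -> A),
     (forall k, I (a k) /\ J (b k)) /\ x = \sum_k a k * b k].

(* For subspaces W `<=` U of V: dim U / W = d, witnessed by a family e whose
   classes modulo W form a basis of U / W. *)
Definition quot_dim (K : fieldType) (V : lmodType K) (U W : set V) (d : nat) :=
  exists e : 'I_d -> V,
    [/\ forall i, U (e i),
        forall c : 'I_d -> K, W (\sum_i c i *: e i) -> forall i, c i = 0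
      & forall u, U u -> exists c : 'I_d -> K, W (u - \sum_i c i *: e i)].

Definition prime_chain (A : comNzRingType) (d : nat) :=
  exists P : 'I_d.+1 -> prime_idealr A, forall i j : 'I_d.+1, (i < j)%N ->
    {subset P i <= P j} /\ ~ {subset P j <= P i}.

Definition krull_dim (A : comNzRingType) (d : nat) :=
  prime_chain A d /\ forall e, prime_chain A e -> (e <= d)%N.

Definition embedding_dim (K : fieldType) (n : nat) (p : signature n) (d : nat) :=
  let m := @maxideal K n p in @quot_dim K (canring K p) m (ideal_mul m m) d.

Definition hypersurface (K : fieldType) (n : nat) (p : signature n) :=
  exists d, krull_dim (canring K p) d /\ embedding_dim K p d.+1.

(* Main.v *)
From HB Require Import structures.
Require Import Defs.
From mathcomp Require Import all_boot all_order all_algebra.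
From mathcomp Require Import ssrcomplements mpoly.
From mathcomp Require Import complex boolp classical_sets cardinality reals.
From mathcomp Require Import zify ring lra.

(* Fix an index i0. For 0 < k <= p_i0 every monomial of degree k omega has
   X_i0-exponent at least p_i0 - k, so a product of two elements of R of
   positive degrees summing to k has X_i0-exponents at least 2 p_i0 - k. Hence
   a monomial of degree k omega with X_i0-exponent exactly p_i0 - k is a new
   generator: its class survives in m / m^2, as one sees by evaluating the
   other variables at a point of sum_(i != i0) x_i^p_i = 0 with all x_i != 0.
   Such a monomial exists as soon as sum_i ceil(k / p_i) <= k. Since sums of
   n - 1 unit fractions that are < 1 stay bounded away from 1, this holds for
   every k in [k0, p_i0], where k0 depends only on n. So the embedding
   dimension is more than p_i0 - k0. On the other hand the Krull dimension is
   at most n: elements separating the members of a chain of primes are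
   algebraically independent, while any n + 1 elements of a quotient of
   K[X_1, ..., X_n] are algebraically dependent. Thus every p_i is bounded. *)

Set Implicit Arguments.
Unset Strict Implicit.
Unset Printing Implicit Defensive.
Import Order.TTheory GRing.Theory Num.Theory.
Import Quotient.Exports.
Local Open Scope ring_scope.
Local Open Scope quotient_scope.

(** * Gaps below a bound for sums of unit fractions *)

(** Induction on the number of terms. If all terms are at most [x / 2 / N.+1], the sum is at most
    [x / 2]. Otherwise some [q] is below [V], and the induction applies to the other terms with
    bound [x - 1 / q]; only finitely many [q] arise. *)
Lemma unit_fractions_gap (N : nat) (x : rat) : 0 < x ->
  exists2 e : rat, 0 < e & forall s : seq nat, size s = N -> all (leq 1) s ->
    \sum_(q <- s) q%:R^-1 < x -> \sum_(q <- s) q%:R^-1 <= x - e.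
Proof.
elim: N x => [|N IH] x x_gt0.
  by exists x => // s /size0nil-> _ _; rewrite big_nil subrr.
pose V := (Num.truncn (2 * N.+1%:R / x)).+1.
have lt_V (q : nat) : (0 < q)%N -> x / 2 / N.+1%:R < q%:R^-1 -> (q < V)%N.
  move=> q_gt0 hq; have : q%:R < 2 * N.+1%:R / x :> rat.
    rewrite ltr_pdivlMr // mulrC -ltr_pdivlMr ?ltr0n //.
    move: hq; rewrite ltr_pdivrMr ?ltr0Sn //; lra.
  by move=> /lt_trans/(_ (truncnS_gt _)); rewrite ltr_nat.
have gap (v : 'I_V) : exists e : rat, 0 < e /\ (x - v%:R^-1 > 0 ->
    forall s : seq nat, size s = N -> all (leq 1) s ->
    \sum_(q <- s) q%:R^-1 < x - v%:R^-1 ->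
    \sum_(q <- s) q%:R^-1 <= x - v%:R^-1 - e).
  (* If [x - v%:R^-1] is not positive, nothing is claimed and 1 is an arbitrary positive value. *)
  case: (ltP 0 (x - v%:R^-1)) => [/IH[e e_gt0 he]|_]; last by exists 1.
  by exists e.
have /fin_all_exists[e he] := gap.
pose e' := \big[Num.min/(x / 2)]_v e v.
have e'_gt0 : 0 < e'.
  rewrite /e'; elim/big_ind: _ => [|a b a0 b0|v _]; first by rewrite divr_gt0.
    by rewrite lt_min a0.
  by case: (he v).
exists e' => // s ss s_gt0 sx.
case: (boolP (has (fun q : nat => x / 2 / N.+1%:R < q%:R^-1) s)); last first.
  rewrite -all_predC => /allP hs.
  apply: (@le_trans _ _ (x / 2)); last first.
    have : e' <= x / 2 by rewrite /e' bigmin_idl ge_min lexx.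
    lra.
  rewrite [leRHS](_ : _ = \sum_(q <- s) (x / 2 / N.+1%:R)); last first.
    by rewrite big_tnth sumr_const card_ord ss -(mulr_natr (x / 2 / _)) divfK ?pnatr_eq0.
  by rewrite big_seq [leRHS]big_seq ler_sum // => q /hs; rewrite /= -leNgt.
case/hasP => q qs xq.
have q_gt0 : (0 < q)%N by move/allP: s_gt0 => /(_ q qs).
have qV := lt_V q q_gt0 xq.
have [_ hq] := he (Ordinal qV); rewrite /= in hq.
move: sx; rewrite !(big_rem q qs) /= => sx.
have r_ge0 : 0 <= \sum_(y <- rem q s) y%:R^-1 :> rat.
  by apply: sumr_ge0 => y _; rewrite invr_ge0.
have : e' <= e (Ordinal qV) by apply: bigmin_le_cond.
have : \sum_(y <- rem q s) y%:R^-1 <= x - q%:R^-1 - e (Ordinal qV).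
  apply: hq; first by lra.
  - by rewrite size_rem // ss.
  - by apply/allP => y /mem_rem; apply: (allP s_gt0).
  - by lra.
lra.
Qed.

(** * A lower bound for the dimension of a quotient space *)

(** The matrix of the [l k (t k')] is diagonal with nonzero diagonal, so the [t k] are independent
    modulo [W], while [d] elements span [U] modulo [W]. *)
Lemma quot_dim_lower (K : fieldType) (V : lmodType K) (U W : set V) (d N : nat)
    (t : 'I_N -> V) (l : 'I_N -> V -> K) :
    (forall k, scalar (l k)) -> (forall k, U (t k)) ->
    (forall k v, W v -> l k v = 0) ->
    (forall k k', (l k (t k') == 0) = (k != k')) ->
  quot_dim U W d -> (N <= d)%N.
Proof.
move=> l_lin Ut lW lt [e [_ _ eU]].
have l0 k : l k 0 = 0.
  by have := l_lin k (-1) 0 0; rewrite scaler0 addr0 mulN1r addNr.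
have [c hc] := fin_all_exists (fun k => eU _ (Ut k)).
have l_t k k' : l k (t k') = \sum_i c k' i * l k (e i).
  rewrite -[t k'](subrK (\sum_i c k' i *: e i)) -[X in X + _]scale1r l_lin.
  rewrite (lW _ _ (hc k')) mulr0 add0r.
  by elim: (index_enum _) => [|i s IH]; rewrite ?big_nil ?big_cons // l_lin IH.
rewrite leqNgt; apply/negP => lt_dN.
pose C := \matrix_(k < N, i < d) c k i.
have : kermx C != 0.
  by rewrite -mxrank_eq0 mxrank_ker subn_eq0 -ltnNge
    (leq_ltn_trans (rank_leq_col C)).
case/rowV0Pn => v /sub_kermxP vC /rV0Pn[k /negP]; apply.
have : \sum_k' v 0 k' * l k (t k') = 0.
  under eq_bigr => k' _ do rewrite l_t big_distrr /=.
  rewrite exchange_big big1 //= => i _.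
  move/rowP: vC => /(_ i); rewrite !mxE => vC.
  under eq_bigr => k' _ do rewrite mulrA.
  rewrite -big_distrl /= [X in X * _](_ : _ = 0) ?mul0r // -[RHS]vC.
  by apply: eq_bigr => k' _; rewrite mxE.
rewrite (bigD1 k) //= big1 ?addr0 => [/eqP|k' k'k].
  by rewrite mulf_eq0 lt eqxx orbF.
by apply/eqP; rewrite mulf_eq0 lt (eq_sym k) k'k orbT.
Qed.

(** * The Krull dimension of the canonical ring *)

(** Descending induction on [e]. For [e = 0] and nonzero constants [c i], it says that elements
    separating successive primes are algebraically independent. The set [S] varies because the
    induction step passes to a subset. *)
Lemma prime_chain_independent (A : comNzRingType) (P : nat -> prime_idealr A)
    (x : nat -> A) (d : nat) (I : finType) (al : I -> nat -> nat) (c : I -> A)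
    (e : nat) (S : {set I}) :
    (forall j, (j < d)%N -> {subset P j <= P j.+1}) ->
    (forall j, (j < d)%N -> x j \in P j.+1 /\ x j \notin P j) ->
    (e <= d)%N -> S != finset.set0 -> (forall i, i \in S -> c i \notin P d) ->
    {in S &, forall i i',
      (forall j, (e <= j < d)%N -> al i j = al i' j) -> i = i'} ->
  \sum_(i in S) c i * \prod_(e <= j < d) x j ^+ al i j \notin P e.
Proof.
move=> subP xP le_ed; rewrite -(subKn le_ed); move: (d - e)%N (leq_subr e d).
move=> k; elim: k S => [|k IH] S lt_kd; rewrite ?subn0.
  (* No variable is left, so injectivity of the exponents leaves a single term. *)
  move=> /finset.set0Pn[i iS] cP al_inj.
  rewrite (big_pred1 i) => [|i' /=]; first by rewrite big_geq // mulr1; apply: cP.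
  apply/idP/eqP => [i'S|->//]; apply: al_inj => // j; lia.
set f := (d - k.+1)%N => S_n0 cP al_inj.
have ltfd : (f < d)%N by rewrite /f; lia.
have Ef : f.+1 = (d - k)%N by rewrite /f; lia.
case/finset.set0Pn: (S_n0) => i0 i0S.
(* Divide by the least power of x_f; modulo P_(f+1) only the terms where the
   exponent of x_f is least survive. *)
case: (@arg_minnP _ i0 (mem S) (al^~ f) i0S) => i1 /= i1S min_i1.
pose m := al i1 f.
rewrite (eq_bigr (fun i => x f ^+ m * (c i * x f ^+ (al i f - m) *
    \prod_(f.+1 <= j < d) x j ^+ al i j))); last first.
  move=> i iS; rewrite big_ltn // !mulrA; congr (_ * _).
  by rewrite mulrC [RHS]mulrAC -exprD subnKC // min_i1.
rewrite -big_distrr /= prime_idealrM negb_or; apply/andP; split.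
  have [_ xnP] := xP f ltfd.
  elim: m => [|m IHm]; first by rewrite expr0 idealr1.
  by rewrite exprS prime_idealrM negb_or xnP.
apply/negP => /(subP f ltfd); apply/negP.
pose S' := [set i in S | al i f == m].
have : \sum_(i in S') c i * \prod_(f.+1 <= j < d) x j ^+ al i j \notin P f.+1.
  rewrite Ef; apply: IH; rewrite ?(ltnW lt_kd) //.
  - by apply/finset.set0Pn; exists i1; rewrite inE i1S /m eqxx.
  - by move=> i; rewrite inE => /andP[/cP].
  rewrite -Ef => i i'; rewrite !inE => /andP[iS /eqP im] /andP[i'S /eqP i'm] h.
  apply: al_inj => // j /andP[]; rewrite leq_eqVlt => /orP[/eqP<-|? ?].
    by rewrite im i'm.
  by apply: h; apply/andP.
apply: contra.
rewrite (bigID (fun i => al i f == m)) /= rpredDr; last first.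
  apply: rpred_sum => i /andP[iS im].
  have lt_mi : (0 < al i f - m)%N by rewrite subn_gt0 ltn_neqAle eq_sym im min_i1.
  rewrite -(prednK lt_mi) exprSr mulrA mulrAC idealMr //.
  by case: (xP f ltfd).
rewrite (eq_bigl (mem S')) => [|i]; last by rewrite !inE.
rewrite [X in X \in _ -> _](eq_bigr
  (fun i => c i * \prod_(f.+1 <= j < d) x j ^+ al i j)) //.
by move=> i; rewrite !inE => /andP[_ /eqP->]; rewrite subnn expr0 mulr1.
Qed.

Lemma msize_prod_le (K : fieldType) (n : nat) (I : finType) (P : I -> {mpoly K[n]})
    (a : I -> nat) (D N : nat) :
    (forall i, msize (P i) <= D.+1)%N -> (forall i, a i <= N)%N ->
  (msize (\prod_i P i ^+ a i) <= (#|I| * (N * D)).+1)%N.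
Proof.
have mulB (p q : {mpoly K[n]}) b c : (msize p <= b.+1)%N -> (msize q <= c.+1)%N ->
    (msize (p * q) <= (b + c).+1)%N.
  have [->|p0] := eqVneq p 0; first by rewrite mul0r msize0.
  have [->|q0] := eqVneq q 0; first by rewrite mulr0 msize0.
  by rewrite msizeM // => hp hq; rewrite -subn1 leq_subLR add1n -addSn -addnS leq_add.
move=> hD hN; have hX i : (msize (P i ^+ a i) <= (N * D).+1)%N.
  have : (msize (P i ^+ a i) <= (a i * D).+1)%N.
    elim: (a i) => [|k IH]; first by rewrite expr0 msize1.
    by rewrite exprS mulSn; apply: mulB.
  by move=> /leq_trans; apply; rewrite ltnS leq_mul2r hN orbT.
rewrite -sum1_card big_distrl /=.
elim/big_rec2: _ => [|i b p _ IH]; first by rewrite msize1.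
by rewrite mul1n; apply: mulB.
Qed.

(** Counting: the [N ^ d] products with exponents below [N] lie in the span of the [(B * N) ^ n]
    monomials with exponents below [B * N], which are fewer. *)
Lemma mpoly_alg_dependent (K : fieldType) (n d : nat) (P : 'I_d -> {mpoly K[n]}) :
  (n < d)%N -> exists N (c : {ffun 'I_d -> 'I_N} -> K), (exists f, c f != 0) /\
    \sum_f c f *: \prod_i P i ^+ f i = 0.
Proof.
move=> lt_nd.
pose D := \max_i msize (P i).
have PD i : (msize (P i) <= D.+1)%N by rewrite leqW // (leq_bigmax i).
(* As [N > B ^ n], one gets [(B * N) ^ n < N ^ n.+1 <= N ^ d]. *)
pose B := (d * D).+1; pose N := (B ^ n).+1.
have Bsize (f : {ffun 'I_d -> 'I_N}) : (msize (\prod_i P i ^+ f i) <= B * N)%N.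
  have hf i : (f i <= N.-1)%N by rewrite -ltnS.
  apply: leq_trans (msize_prod_le PD hf) _; rewrite card_ord /N /=.
  by rewrite mulnCA mulnC /B mulSn mulnS; lia.
have lt_card : (#|{ffun 'I_n -> 'I_(B * N)}| < #|{ffun 'I_d -> 'I_N}|)%N.
  rewrite !card_ffun !card_ord expnMn.
  apply: (@leq_trans (N ^ n.+1)); last by rewrite leq_pexp2l.
  by rewrite expnS ltn_mul2r expn_gt0 ltnS leqnn.
pose M := \matrix_(i < #|{ffun 'I_d -> 'I_N}|, j < #|{ffun 'I_n -> 'I_(B * N)}|)
  (\prod_k P k ^+ (enum_val i : {ffun 'I_d -> 'I_N}) k)@_
     [multinom nat_of_ord ((enum_val j : {ffun _ -> _}) k) | k < n].
have : kermx M != 0.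
  rewrite -mxrank_eq0 mxrank_ker subn_eq0 -ltnNge.
  exact: leq_ltn_trans (rank_leq_col M) lt_card.
case/rowV0Pn => v /sub_kermxP vM v0.
exists N, (fun f => v 0 (enum_rank f)); split.
  case/rV0Pn: v0 => i vi; exists (enum_val i).
  by rewrite enum_valK.
apply/mpolyP => m; rewrite mcoeff0 raddf_sum /=.
(* Monomials of degree at least [B * N] occur in none of the products; every other monomial indexes
   a column of [M]. *)
case: (ltnP (mdeg m) (B * N)) => [lt_m|le_m]; last first.
  apply: big1 => f _; rewrite mcoeffZ memN_msupp_eq0 ?mulr0 //.
  exact/msize_mdeg_ge/(leq_trans (Bsize f)).
have hm k : (m k < B * N)%N.
  by apply: leq_ltn_trans lt_m; rewrite mdegE (bigD1 k) //= leq_addr.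
pose g : {ffun 'I_n -> 'I_(B * N)} := [ffun k => Ordinal (hm k)].
move/rowP: vM => /(_ (enum_rank g)); rewrite !mxE => vM.
rewrite -[RHS]vM (reindex enum_rank) /=; last first.
  by exists enum_val => i _; rewrite ?enum_valK ?enum_rankK.
apply: eq_bigr => f _; rewrite mcoeffZ !mxE !enum_rankK.
congr (_ * _@__); apply/mnmP => k; by rewrite mnmE ffunE.
Qed.

(** If [d > n], polynomials representing the [d] separating elements satisfy a nontrivial relation,
    whose image in [T] contradicts independence along the chain. *)
Lemma prime_chain_canring_le (K : fieldType) (n : nat) (p : signature n) (d : nat) :
  prime_chain (canring K p) d -> (d <= n)%N.
Proof.
move=> [P hP]; rewrite leqNgt; apply/negP => lt_nd.
pose Q j := P (inord j).
have [x hx] : exists x : 'I_d -> canring K p, forall j,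
    x j \in Q j.+1 /\ x j \notin Q j.
  apply: (@fin_all_exists _ _ (fun (j : 'I_d) r => r \in Q j.+1 /\ r \notin Q j)) => j.
  have lt_j : ((inord j : 'I_d.+1) < (inord j.+1 : 'I_d.+1))%N.
    by rewrite !inordK ?ltnS // ltnW.
  have [_] := hP _ _ lt_j; apply: contra_notP => h r rQ.
  by apply: contra_notT h => rnQ; exists r.
have [N [c [[f0 cf0]]]] := mpoly_alg_dependent (fun i => repr (val (x i))) lt_nd.
move=> dep.
(* Default values extend the families to all natural indices; only those below [d] are used. *)
pose y j := if insub j is Some i then x i else 0.
pose al (f : {ffun 'I_d -> 'I_N}) j := if insub j is Some i then f i : nat else 0%N.
have yE (j : 'I_d) : y j = x j by rewrite /y valK.
have alE f (j : 'I_d) : al f j = f j by rewrite /al valK.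
pose S := [set f | c f != 0].
have : \sum_(f in S) (c f)%:A * \prod_(0 <= j < d) y j ^+ al f j \notin Q 0%N.
  apply: (@prime_chain_independent _ Q y d).
  - move=> j lt_jd; have lt_j : ((inord j : 'I_d.+1) < (inord j.+1 : 'I_d.+1))%N.
      by rewrite !inordK ?ltnS // ltnW.
    by have [] := hP _ _ lt_j.
  - by move=> j lt_jd; have := hx (Ordinal lt_jd); rewrite -yE.
  - by [].
  - by apply/finset.set0Pn; exists f0; rewrite inE.
  (* A nonzero constant is a unit, so no prime contains it. *)
  - move=> f; rewrite inE => cf; apply/negP => /(idealMr (c f)^-1%:A).
    by rewrite mulr_algl scalerA mulVf // scale1r idealr1.
  - move=> f g _ _ fg; apply/ffunP => j; apply: val_inj.
    by have := fg j; rewrite !alE ltn_ord; apply.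
rewrite [X in X \notin _](_ : _ = 0) ?idealr0 //.
rewrite (eq_bigr (fun f => c f *: \prod_i x i ^+ f i)); last first.
  move=> f _; rewrite mulr_algl big_mkord; congr (_ *: _).
  by apply: eq_bigr => i _; rewrite yE alE.
transitivity (\sum_f c f *: \prod_i x i ^+ f i).
  rewrite [RHS](bigID (mem S)) /= [X in _ + X]big1 ?addr0 // => f.
  by rewrite inE negbK => /eqP->; rewrite scale0r.
apply: val_inj; rewrite raddf0 raddf_sum.
move/(congr1 \pi_(T K p)): dep; rewrite raddf0 raddf_sum => dep.
apply: etrans dep; apply: eq_bigr => f _; rewrite -mul_mpolyC [RHS]rmorphM.
transitivity (\pi_(T K p) (c f)%:MP * val (\prod_i x i ^+ f i)).
  by [].
rewrite !rmorph_prod; congr (_ * _); apply: eq_bigr => i _.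
by rewrite !rmorphXn /= reprK.
Qed.

(** * Monomials whose degree is a multiple of [omega] *)

Definition freeL_coord (n : nat) (j : 'I_n) (u : freeL n) : int := u.1 j.

Lemma freeL_coord_is_zmod_morphism n (j : 'I_n) : zmod_morphism (freeL_coord j).
Proof. by move=> u v; rewrite /freeL_coord /= !ffunE. Qed.
HB.instance Definition _ n (j : 'I_n) :=
  GRing.isZmodMorphism.Build (freeL n) int (freeL_coord j)
    (freeL_coord_is_zmod_morphism j).

Section Degrees.
Variables (n : nat) (p : signature n).

Lemma freeL_eqP (u v : freeL n) :
  u = v <-> (forall j, freeL_coord j u = freeL_coord j v) /\ u.2 = v.2.
Proof.
split=> [->//|[h1 h2]]; case: u v h1 h2 => [u1 u2] [v1 v2] /= h1 ->.
by congr pair; apply/ffunP => j; apply: h1.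
Qed.

Lemma freeL_coordX (i j : 'I_n) : freeL_coord j (freeX i) = (j == i)%:R.
Proof. by rewrite /freeL_coord ffunE. Qed.

Lemma freeL_coordc (j : 'I_n) : freeL_coord j (freec n) = 0.
Proof. by rewrite /freeL_coord ffunE. Qed.

Lemma Xvec_mul i : Xvec p i *+ p i = cvec p.
Proof.
rewrite -raddfMn; apply/eqP; rewrite -Quotient.idealrBE; apply/asboolP.
exists (fun j => (j == i)%:R); rewrite (bigD1 i) //= eqxx mulr1z big1 ?addr0 //.
by move=> j /negPf->; rewrite mulr0z.
Qed.

(** In the free group the two sides differ by [\sum_i (m i + k) X_i - k c]; comparing coordinates
    with [\sum_i a i (p i X_i - c)] gives the equations. *)
Lemma mdegL_omegaP (m : 'X_{1..n}) k : mdegL p m = omega p *+ k <->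
  exists2 a : 'I_n -> nat, (forall i, m i + k = a i * p i)%N & (\sum_i a i = k)%N.
Proof.
have -> : mdegL p m = \pi_(L p) (\sum_i freeX i *+ m i).
  by rewrite raddf_sum; apply: eq_bigr => i _; rewrite raddfMn.
have -> : omega p *+ k = \pi_(L p) ((freec n - \sum_i freeX i) *+ k).
  by rewrite raddfMn raddfB raddf_sum.
have relP (a : 'I_n -> int) :
    \sum_i freeX i *+ m i - (freec n - \sum_i freeX i) *+ k =
      \sum_i (freeX i *+ p i - freec n) *~ a i <->
    (forall i, (m i + k)%:R = a i * (p i)%:R) /\ k%:R = \sum_i a i.
  have sumX (f : 'I_n -> int) j :
      \sum_i freeL_coord j (freeX i) * f i = f j.
    rewrite (bigD1 j) //= freeL_coordX eqxx mul1r big1 ?addr0 // => i.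
    by rewrite freeL_coordX eq_sym => /negPf->; rewrite mul0r.
  have E j : freeL_coord j
      (\sum_i freeX i *+ m i - (freec n - \sum_i freeX i) *+ k) = (m j + k)%:R.
      rewrite raddfB raddf_sum raddfMn raddfB raddf_sum /= freeL_coordc sub0r.
      under eq_bigr => i _ do rewrite raddfMn -mulr_natr.
      rewrite (_ : \sum_(i < n) freeL_coord j (freeX i) = 1); last first.
        by rewrite -(sumX (fun=> 1) j); apply: eq_bigr => i _; rewrite mulr1.
      by rewrite sumX mulNrn opprK natrD.
  have E' j : freeL_coord j (\sum_i (freeX i *+ p i - freec n) *~ a i) =
      a j * (p j)%:R.
      rewrite raddf_sum -(sumX (fun i => a i * (p i)%:R)).
      apply: eq_bigr => i _; rewrite raddfMz raddfB raddfMn /= freeL_coordc subr0.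
      by rewrite -mulrzr -mulr_natr intz; ring.
  have E2 : (\sum_i freeX i *+ m i - (freec n - \sum_i freeX i) *+ k).2 = - k%:R :> int.
    rewrite (raddfB snd) (raddf_sum snd) (raddfMn snd) (raddfB snd) (raddf_sum snd) /=.
    rewrite big1 => [|i _]; last by rewrite (raddfMn snd) /= mul0rn.
    by rewrite [in X in _ - X *+ _]big1 // subr0 sub0r.
  have E2' : (\sum_i (freeX i *+ p i - freec n) *~ a i).2 = - \sum_i a i :> int.
    rewrite (raddf_sum snd) -sumrN; apply: eq_bigr => i _.
    by rewrite (raddfMz snd) (raddfB snd) (raddfMn snd) /= mul0rn sub0r mulNrz intz.
  rewrite freeL_eqP E2 E2'; split=> -[h1 h2]; split=> [j|].
  - by rewrite -E h1 E'.
  - exact: oppr_inj.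
  - by rewrite E E' h1.
  - by rewrite h2.
split=> [/eqP|[a ha sa]].
  rewrite -Quotient.idealrBE => /asboolP[a /relP[ha sa]].
  (* Since [m i + k >= 0] and [p i > 0]; hence absolute values turn the [a i] into naturals without
     loss. *)
  have a_ge0 i : 0 <= a i.
    have : 0 <= a i * (p i)%:R by rewrite -ha.
    by rewrite pmulr_lge0 // ltr0n sig_gt0.
  exists (fun i => `|a i|%N) => [i|].
    by apply/eqP; rewrite -(eqr_nat int) natrM natr_absz ger0_norm // intz -ha.
  apply/eqP; rewrite -(eqr_nat int) sa natr_sum; apply/eqP/eq_bigr => i _.
  by rewrite natr_absz ger0_norm // intz.
apply/eqP; rewrite -Quotient.idealrBE; apply/asboolP.
exists (fun i => (a i)%:R); apply/relP; split => [i|].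
  by rewrite ha natrM.
by rewrite -sa natr_sum.
Qed.

(** Giving [X_i] weight [1 / p i] and [c] weight 1, [omega] has weight [1 - \sum_i 1 / p i], which
    is positive for a signature. *)
Lemma mdegL_omega_inj (m : 'X_{1..n}) k k' :
  mdegL p m = omega p *+ k -> mdegL p m = omega p *+ k' -> k = k'.
Proof.
have [_ sp] := andP (sigvalP p).
have E l : mdegL p m = omega p *+ l ->
    l%:R * (1 - \sum_i (p i)%:R^-1) = \sum_i (m i)%:R / (p i)%:R :> rat.
  move=> /mdegL_omegaP[a ha sa].
  rewrite mulrBr mulr1 -{1}sa natr_sum mulr_sumr -sumrB; apply: eq_bigr => i _.
  have pi0 : (p i)%:R != 0 :> rat by rewrite pnatr_eq0 -lt0n sig_gt0.
  move/(congr1 (fun x => x%:R : rat)): (ha i); rewrite natrD natrM => h.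
  rewrite (_ : (m i)%:R = (a i)%:R * (p i)%:R - l%:R); first by rewrite mulrBl mulfK.
  by rewrite -h addrK.
move=> /E h /E; rewrite -h => /mulIf h'; apply/eqP; rewrite -(eqr_nat rat).
by apply/eqP/esym/h'; rewrite subr_eq0 gt_eqF.
Qed.
End Degrees.

(** * Linear functionals that detect generators *)

Section MonomialFunctional.
Variables (K : fieldType) (n : nat) (w : 'X_{1..n} -> K).

Definition mon_functional (P : {mpoly K[n]}) : K :=
  \sum_(m <- msupp P) P@_m * w m.

(** A summation range shared by several polynomials, as the proof of linearity requires. *)
Lemma mon_functionalE N P : (msize P <= N)%N ->
  mon_functional P = \sum_(m : 'X_{1..n < N}) P@_m * w m.
Proof.
move=> leN; rewrite /mon_functional (big_mksub 'X_{1..n < N}) /=.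
- by rewrite big_rmcond //= => m /memN_msupp_eq0->; rewrite mul0r.
- exact: msupp_uniq.
- by move=> m /msize_mdeg_lt /leq_trans; apply.
Qed.

Lemma mon_functional_is_scalar : scalar mon_functional.
Proof.
move=> a P Q; pose N := maxn (msize (a *: P + Q)) (maxn (msize P) (msize Q)).
rewrite !(@mon_functionalE N) ?leq_max ?leqnn ?orbT //.
rewrite mulr_sumr -big_split /=; apply: eq_bigr => m _.
by rewrite mcoeffD mcoeffZ mulrDl mulrA.
Qed.
HB.instance Definition _ := GRing.isLinear.Build K {mpoly K[n]} K *%R mon_functional
  mon_functional_is_scalar.

Lemma mon_functional_sum (I : Type) (r : seq I) (F : I -> {mpoly K[n]}) :
  mon_functional (\sum_(i <- r) F i) = \sum_(i <- r) mon_functional (F i).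
Proof. exact: linear_sum. Qed.

Lemma mon_functionalZ a P : mon_functional (a *: P) = a * mon_functional P.
Proof. exact: linearZ. Qed.

Lemma mon_functionalX m : mon_functional 'X_[m] = w m.
Proof. by rewrite /mon_functional msuppX big_seq1 mcoeffX eqxx mul1r. Qed.

Lemma mon_functional_eq0 P : (forall m, m \in msupp P -> w m = 0) ->
  mon_functional P = 0.
Proof.
by move=> w0; rewrite /mon_functional big_seq big1 // => m /w0->; rewrite mulr0.
Qed.
End MonomialFunctional.

Section Detector.
Variables (K : fieldType) (n : nat) (p : signature n) (i0 : 'I_n) (x : 'I_n -> K).
Hypothesis x_fermat : \sum_(i | i != i0) x i ^+ p i = 0.

(** The induced functional takes the part of degree [k omega], extracts the coefficient of the power
    [p i0 - k] of [X_i0], and evaluates it at [x]. *)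
Definition det_weight (k : nat) (m : 'X_{1..n}) : K :=
  if (mdegL p m == omega p *+ k) && (m i0 + k == p i0)%N
  then \prod_(i | i != i0) x i ^+ m i else 0.

Lemma mdegLU i : mdegL p (U_(i) *+ p i)%MM = cvec p.
Proof.
rewrite /mdegL (bigD1 i) //= mulmnE mnm1E eqxx mul1n Xvec_mul big1 ?addr0 //.
by move=> j ji; rewrite mulmnE mnm1E eq_sym (negPf ji).
Qed.

(** In a monomial times [fermat], the [i0] term has too large an [X_i0]-exponent. The other terms
    share degree and [X_i0]-exponent, so their weights are either all 0 or a common factor times the
    [x i ^+ p i], which sum to 0. *)
Lemma det_fermat k Q : (0 < k)%N ->
  mon_functional (det_weight k) (Q * fermat K p) = 0.
Proof.
move=> k_gt0; rewrite [Q]mpolyE mulr_suml mon_functional_sum big1 => // m _.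
rewrite -scalerAl mon_functionalZ /fermat [X in mon_functional _ X]mulr_sumr.
rewrite mon_functional_sum.
rewrite [X in _ * X](_ : _ = 0) ?mulr0 //.
under eq_bigr => i _ do rewrite mpolyXn -mpolyXD mon_functionalX /det_weight
   mdegLD mdegLU.
rewrite (bigD1 i0) //= mnmDE mulmnE mnm1E eqxx mul1n.
rewrite [X in _ && X](_ : _ = false) ?andbF ?add0r; last by apply/eqP; lia.
have [_|_] := boolP (mdegL p m + cvec p == omega p *+ k); last by rewrite big1.
have [mk|mk] := eqVneq (m i0 + k)%N (p i0); last first.
  rewrite big1 // => i ii0; rewrite mnmDE mulmnE mnm1E (negPf ii0) mul0n addn0.
  by rewrite (negPf mk).
rewrite (eq_bigr (fun i => (\prod_(j | j != i0) x j ^+ m j) * x i ^+ p i)).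
  by rewrite -mulr_sumr x_fermat mulr0.
move=> i ii0; rewrite mnmDE mulmnE mnm1E (negPf ii0) mul0n addn0 mk eqxx /=.
rewrite (bigD1 i) //= [in RHS](bigD1 i) //= mnmDE mulmnE mnm1E eqxx mul1n exprD.
rewrite mulrAC; congr (_ * _ * _); apply: eq_bigr => j /andP[_ ji].
by rewrite mnmDE mulmnE mnm1E eq_sym (negPf ji) addn0.
Qed.

Definition detector k (r : canring K p) : K :=
  mon_functional (det_weight k) (repr (val r)).

(** Representatives differ by multiples of [fermat], which the functional kills. *)
Lemma detector_pi k (r : canring K p) P : (0 < k)%N -> val r = \pi_(T K p) P ->
  detector k r = mon_functional (det_weight k) P.
Proof.
move=> k_gt0 rP; apply/eqP; rewrite -subr_eq0 -raddfB /=.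
have /asboolP[Q ->] : fermat_ideal p (repr (val r) - P).
  suff : repr (val r) - P \in Idealr.clone {mpoly K[n]} (fermat_ideal p) _ by [].
  by rewrite Quotient.idealrBE reprK rP.
by rewrite det_fermat.
Qed.

Lemma detector_is_scalar k : (0 < k)%N -> scalar (detector k).
Proof.
move=> k_gt0 a r s; rewrite [in RHS]/detector -mon_functional_is_scalar.
apply: detector_pi => //; rewrite -mul_mpolyC [RHS]rmorphD.
rewrite [X in _ = X + _]rmorphM /= !reprK.
exact: (linearP (val : canring K p -> T K p)).
Qed.

Lemma canpart_poly k (r : canring K p) : canpart k r ->
  exists2 P, forall m, m \in msupp P -> mdegL p m = omega p *+ k & val r = \pi_(T K p) P.
Proof. by case=> P [hP rP]; exists P. Qed.

Lemma mdegL_omega_ge (m : 'X_{1..n}) k : (0 < k)%N ->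
  mdegL p m = omega p *+ k -> (p i0 <= m i0 + k)%N.
Proof.
by move=> k0 /mdegL_omegaP[a /(_ i0) h _]; rewrite h leq_pmull //;
  case: (a i0) h => //; lia.
Qed.

Lemma detector_mul k a b (r s : canring K p) : (0 < k <= p i0)%N ->
  canpart a.+1 r -> canpart b.+1 s -> detector k (r * s) = 0.
Proof.
move=> /andP[k_gt0 lekp] /canpart_poly[P hP rP] /canpart_poly[Q hQ sQ].
rewrite (@detector_pi k _ (P * Q)) //; last by rewrite /= rP sQ rmorphM.
apply: mon_functional_eq0 => m /msuppM_le /allpairsP[[m1 m2] /= [/hP d1 /hQ d2 ->]].
rewrite /det_weight; case: ifP => // /andP[/eqP].
have e : mdegL p (m1 + m2)%MM = omega p *+ (a.+1 + b.+1).
  by rewrite mdegLD d1 d2 mulrnDr.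
move=> /(mdegL_omega_inj e) <-; rewrite mnmDE => /eqP h.
(* The two bounds add up to [2 * p i0 <= p i0], which is absurd. *)
have := mdegL_omega_ge (ltn0Sn a) d1; have := mdegL_omega_ge (ltn0Sn b) d2.
have := sig_gt0 p i0; lia.
Qed.

Lemma detector_maxideal2 k (r : canring K p) : (0 < k <= p i0)%N ->
  ideal_mul (@maxideal K n p) (@maxideal K n p) r -> detector k r = 0.
Proof.
move=> hk; have k_gt0 : (0 < k)%N by case/andP: hk.
have dsum N (F : 'I_N -> canring K p) :
    (forall i, detector k (F i) = 0) -> detector k (\sum_i F i) = 0.
  have lin := detector_is_scalar k_gt0.
  move=> F0; elim/big_rec: _ => [|i y _ IH].
    by have := lin (-1) 0 0; rewrite scaler0 addr0 mulN1r addNr.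
  by rewrite -[F i]scale1r lin F0 IH mulr0 addr0.
move=> [N [u [v [uv ->]]]]; apply: (dsum) => j.
have [[Na [a [ha ->]]] [Nb [b [hb ->]]]] := uv j.
rewrite mulr_suml; apply: (dsum) => i; rewrite mulr_sumr; apply: dsum => i'.
exact: detector_mul hk (ha _) (hb _).
Qed.
End Detector.

(** * Test monomials and a point with nonzero coordinates *)

(** The quotient is the ceiling of [k / q]. *)
Lemma ceil_divn_le (k q : nat) : (0 < q)%N ->
  (k <= (k + q.-1) %/ q * q)%N /\ ((k + q.-1) %/ q * q <= k + q.-1)%N.
Proof.
move=> q_gt0; split; last exact: leq_divM.
have := divn_eq (k + q.-1) q; have := ltn_pmod (k + q.-1) q_gt0; lia.
Qed.

Lemma exists_neq_ord (n : nat) (i0 : 'I_n) : (1 < n)%N -> exists j, j != i0.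
Proof.
move=> n_gt1; have : (0 < #|[set~ i0]|)%N.
  by rewrite cardsC1 card_ord -subn1 subn_gt0.
by case/card_gt0P => j; rewrite !inE; exists j.
Qed.

Section TestMonomial.
Variables (n : nat) (p : signature n) (i0 : 'I_n).

(** By [mdegL_omegaP] one needs integers [a i >= k / p i] with sum [k]; the ceilings are the least
    choice, and the one at [i0] is 1. *)
Lemma omega_monomial (k : nat) : (0 < k <= p i0)%N -> (1 < n)%N ->
    (\sum_i (k + (p i).-1) %/ p i <= k)%N ->
  exists2 m : 'X_{1..n}, mdegL p m = omega p *+ k & (m i0 + k = p i0)%N.
Proof.
move=> /andP[k_gt0 le_kp] n_gt1 le_sk.
have [j ji0] := exists_neq_ord i0 n_gt1.
set c := fun i => ((k + (p i).-1) %/ p i)%N in le_sk.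
(* The surplus goes to an index [j] other than [i0], which keeps [a i0 = 1]. *)
pose a i := (c i + (i == j) * (k - \sum_i c i))%N.
have a_ge i : (k <= a i * p i)%N.
  by have [h _] := ceil_divn_le k (sig_gt0 p i); rewrite mulnDl (leq_trans h) ?leq_addr.
exists [multinom (a i * p i - k)%N | i < n].
  apply/mdegL_omegaP; exists a => [i|]; first by rewrite mnmE subnK.
  rewrite big_split /= [X in (_ + X)%N](bigD1 j) //= eqxx mul1n.
  by rewrite [X in (_ + (_ + X))%N]big1 ?addn0 ?subnKC // => i /negPf->.
rewrite mnmE subnK // /a eq_sym (negPf ji0) addn0 /c.
rewrite (_ : (k + (p i0).-1) %/ p i0 = 1)%N ?mul1n //.
rewrite -[k](subnK k_gt0) addn1 addSnnS prednK ?sig_gt0 // divnDr //.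
by rewrite divnn sig_gt0 divn_small //; lia.
Qed.
End TestMonomial.

(** All coordinates are 1 except [x j], for some [j != i0]: a [p j]-th root of [-(n - 2)],
    cancelling the other [n - 2] terms and nonzero as [n > 2]. *)
Lemma fermat_point (K : numClosedFieldType) (n : nat) (p : signature n) (i0 : 'I_n) :
  (2 < n)%N -> exists x : 'I_n -> K,
    (forall i, x i != 0) /\ \sum_(i | i != i0) x i ^+ p i = 0.
Proof.
move=> n_gt2.
have [j ji0] := exists_neq_ord i0 (ltnW n_gt2).
exists (fun i => if i == j then (p j).-root (- (n - 2)%:R) else 1); split.
  move=> i; case: ifP => _; last exact: oner_neq0.
  by rewrite rootC_eq0 ?sig_gt0 // oppr_eq0 pnatr_eq0 subn_eq0 -ltnNge.
rewrite (bigD1 j) //= eqxx rootCK ?sig_gt0 //.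
rewrite (eq_bigr (fun=> 1)) => [|i /andP[_ /negPf->]]; last by rewrite expr1n.
rewrite sumr_const (_ : #|_| = n - 2)%N ?addNr //.
have := cardsC [set i0; j]; rewrite cards2 eq_sym ji0 card_ord.
rewrite (_ : #|~: _| = #|[pred i | i != i0 & i != j]|); last first.
  by apply: eq_card => i; rewrite !inE negb_or.
by move=> h; rewrite -[X in (X - _)%N]h addKn.
Qed.

(** * Bounding the exponents by the embedding dimension *)

Section EmbeddingBound.
Variables (K : fieldType) (n : nat) (p : signature n) (i0 : 'I_n) (x : 'I_n -> K).
Hypothesis x_neq0 : forall i, x i != 0.
Hypothesis x_fermat : \sum_(i | i != i0) x i ^+ p i = 0.

(** The test monomials for [k0 <= k <= p i0] and their detectors fit [quot_dim_lower], whence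
    [p i0 - k0 + 1 <= d]. *)
Lemma embedding_dim_lower (k0 d : nat) : (0 < k0)%N -> (1 < n)%N ->
    (forall k, (k0 <= k <= p i0)%N -> (\sum_i (k + (p i).-1) %/ p i <= k)%N) ->
  embedding_dim K p d -> (p i0 < k0 + d)%N.
Proof.
move=> k0_gt0 n_gt1 hk; case: (ltnP (p i0) k0) => [lt_pk|le_kp].
  by rewrite ltn_addr.
pose N := (p i0 - k0).+1; pose kk (i : 'I_N) := (k0 + i)%N.
have kkP i : (k0 <= kk i <= p i0)%N.
  by rewrite leq_addr /= -leq_subRL // -ltnS ltn_ord.
have kkP' i : (0 < kk i <= p i0)%N.
  by have /andP[h ->] := kkP i; rewrite (leq_trans k0_gt0).
have [m hm] := fin_all_exists2 (fun i => omega_monomial (kkP' i) n_gt1 (hk _ (kkP i))).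
move=> hm'.
have Tm i : Tpart (omega p *+ kk i) (\pi_(T K p) 'X_[m i]).
  by exists 'X_[m i]; split=> // m'; rewrite msuppX inE => /eqP->.
pose t i : canring K p := Canring (is_canonical_part (Tm i)).
suff : quot_dim (@maxideal K n p)
    (ideal_mul (@maxideal K n p) (@maxideal K n p)) d -> (N <= d)%N.
  by move=> h /h; rewrite /N; lia.
apply: (@quot_dim_lower _ _ _ _ _ _ t (fun i => detector i0 x (kk i))).
- by move=> i; apply: detector_is_scalar => //; case/andP: (kkP' i).
(* [maxideal] lists degree [k.+1] at index [k], hence the predecessor. *)
- move=> i; exists (kk i), (fun j => if j == (kk i).-1 then t i else 0).
  have k_gt0 : (0 < kk i)%N by case/andP: (kkP' i).
  split=> [k|].
    by case: eqP => [->|_]; [rewrite /canpart /= prednK | exact: Tpart0].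
  have lt_k : ((kk i).-1 < kk i)%N by rewrite prednK.
  rewrite (bigD1 (Ordinal lt_k)) //= eqxx.
  by rewrite big1 ?addr0 // => j; rewrite -val_eqE /= => /negPf->.
- by move=> i r; apply: detector_maxideal2.
- move=> i i'; have k_gt0 : (0 < kk i)%N by case/andP: (kkP' i).
  rewrite (@detector_pi _ _ _ _ _ x_fermat _ _ 'X_[m i']) // mon_functionalX.
  rewrite /det_weight; have [->|ii'] /= := eqVneq i i'.
    rewrite hm hm' !eqxx /=; apply/negbTE/prodf_neq0 => j _.
    exact: expf_neq0.
  (* A nonzero off-diagonal value would give one monomial two different degrees. *)
  case: ifP => [/andP[/eqP h _]|]; rewrite ?eqxx //.
  have := mdegL_omega_inj (hm i') h => /addnI/val_inj e.
  by rewrite e eqxx in ii'.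
Qed.
End EmbeddingBound.

(** The gap [e] for [n.-1] unit fractions with sum below 1 depends only on [n], which makes the
    bound uniform in [p]. *)
Lemma embedding_dim_bound (K : numClosedFieldType) (n : nat) : (2 < n)%N ->
  exists B, forall (p : signature n) d, embedding_dim K p d ->
    forall i, (p i < B + d)%N.
Proof.
move=> n_gt2; have [e e_gt0 he] := unit_fractions_gap n.-1 (@ltr01 rat).
(* Chosen so that [n <= k * e] for all [k >= k0]. *)
pose k0 := (Num.truncn (n%:R / e)).+1; exists k0 => p d edim i0.
have [x [x0 xF]] := fermat_point K p i0 n_gt2.
apply: (embedding_dim_lower x0 xF) edim => //; first exact: ltnW.
move=> k /andP[le_k0k le_kp].
have gap : \sum_(i | i != i0) (p i)%:R^-1 <= 1 - e.
  have := he [seq p i | i <- enum (predC1 i0)].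
  rewrite size_map -cardE big_map big_enum /=; apply.
  - by have := cardC1 i0; rewrite card_ord.
  - by apply/allP => _ /mapP[i _ ->]; apply: sig_gt0.
  - have [_] := andP (sigvalP p); rewrite (bigD1 i0) //=; apply: le_lt_trans.
    by rewrite lerDr invr_ge0.
have ke : n%:R <= k%:R * e.
  rewrite -ler_pdivrMr // ltW //.
  by apply: lt_le_trans (truncnS_gt _) _; rewrite ler_nat.
have term i : ((k + (p i).-1) %/ p i)%:R <= k%:R / (p i)%:R + 1 :> rat.
  have p_gt0 : (0 : rat) < (p i)%:R by rewrite ltr0n sig_gt0.
  rewrite -(ler_pM2r p_gt0) mulrDl mul1r divfK ?gt_eqF // -natrM -natrD ler_nat.
  by have [_] := ceil_divn_le k (sig_gt0 p i); lia.
have term0 : ((k + (p i0).-1) %/ p i0)%:R <= 1 :> rat.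
  rewrite lern1 -ltnS ltn_divLR ?sig_gt0 //; have := sig_gt0 p i0; lia.
rewrite -(ler_nat rat) (bigD1 i0) //= natrD natr_sum.
(* This middle term is at most [1 + k * (1 - e) + (n - 1) = k + n - k * e <= k]. *)
apply: (@le_trans _ _ (1 + \sum_(i | i != i0) (k%:R / (p i)%:R + 1))).
  by apply: lerD => //; apply: ler_sum => i _.
rewrite big_split /= -mulr_sumr sumr_const (_ : #|_| = n.-1); last first.
  by rewrite -[in RHS](card_ord n) -(cardC1 i0).
have : k%:R * \sum_(i | i != i0) (p i)%:R^-1 <= k%:R * (1 - e) :> rat.
  by rewrite ler_wpM2l.
have : n%:R = n.-1%:R + 1 :> rat by rewrite -[in LHS](ltn_predK n_gt2) -addn1 natrD.
lra.
Qed.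

(** * Finiteness of the set of signatures *)

Lemma finite_bounded_signatures (n B : nat) :
  finite_set [set p : signature n | forall i, (p i < B)%N]%classic.
Proof.
pose f (p : signature n) := val p.
pose g (h : {ffun 'I_n -> 'I_B}) := [ffun i => nat_of_ord (h i)].
apply: (@sub_finite_set _ _ (f @^-1` [set g h | h in setT])%classic).
  move=> p /= hp; exists [ffun i => Ordinal (hp i)] => //.
  by apply/ffunP => i; rewrite !ffunE.
apply: finite_preimage; first by move=> p q _ _; apply: val_inj.
exact/finite_image/finite_finset.
Qed.

Local Open Scope classical_set_scope.

(* R[i] is the field of complex numbers over the real numbers R. *)
Theorem theorem1p2 (R : realType) (n : nat) (hn : (4 <= n)%N) :
  finite_set [set p : signature n | hypersurface R[i] p].
Proof.
have [B hB] := embedding_dim_bound R[i] (ltnW hn).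
(* Krull dimension [d <= n] means embedding dimension [d.+1 <= n.+1], so every exponent is below
   [B + n.+1]. *)
apply: sub_finite_set (@finite_bounded_signatures n (B + n.+1)).
move=> p [d [[/prime_chain_canring_le le_dn _] edim]] i.
by apply: leq_trans (hB p d.+1 edim i) _; rewrite leq_add2l ltnS.
Qed.
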